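(* Let $X$ be a completely regular topological space. The set $\mathbb{H}_{nf}(X)$ of nearly finite Hausdorff continuous functions on $X$ is a complete metric space with respect to the metric \[ \rho(f,g)=\sup_{x\in X\setminus(\Gamma_f\cup\Gamma_g)}\frac{|(f\ominus g)(x)|}{1+|(f\ominus g)(x)|},\qquad f,g\in\mathbb{H}_{nf}(X). \]
   Context: Notation: $\overline{\mathbb{R}}=\mathbb{R}\cup\{\pm\infty\}$ and $\mathbb{I}\overline{\mathbb{R}}=\{[\underline{a},\overline{a}]:\underline{a},\overline{a}\in\overline{\mathbb{R}},\ \underline{a}\le\overline{a}\}$; $a\in\overline{\mathbb{R}}$ is identified with $[a,a]$. The modulus of $a=[\underline{a},\overline{a}]$ is $|a|=\max\{|\underline{a}|,|\overline{a}|\}$. An interval function $f:X\to\mathbb{I}\overline{\mathbb{R}}$ is S-continuous if its graph $\{(x,y): x\in X,\ y\in f(x)\}$ is a closed subset of $X\times\overline{\mathbb{R}}$. For interval functions, $\varphi\subseteq f$ means $\varphi(x)\subseteq f(x)$ for all $x\in X$. An interval function $f$ is Hausdorff continuous (H-continuous) if it is S-continuous and minimal with respect to inclusion: whenever $\varphi:X\to\mathbb{I}\overline{\mathbb{R}}$ is S-continuous and $\varphi\subseteq f$, then $\varphi=f$. $\mathbb{H}(X)$ denotes the set of all H-continuous functions on $X$. For an H-continuous function $f$ let $\Gamma_f=\{x\in X: -\infty\in f(x)\text{ or }+\infty\in f(x)\}$; $f$ is nearly finite if $\Gamma_f$ is closed and nowhere dense in $X$. $\mathbb{H}_{nf}(X)$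 is the set of all nearly finite H-continuous functions on $X$. Interval addition: for $A,B\in\mathbb{I}\overline{\mathbb{R}}$, $A+B=\{a+b:a\in A,b\in B\}$, with the convention $-\infty+(+\infty)=[-\infty,+\infty]$ (the whole interval being included when such a combination of points occurs). Point-wise sum: $(f+g)(x)=f(x)+g(x)$. For $f,g\in\mathbb{H}_{nf}(X)$ the function $f+g$ is S-continuous and contains exactly one H-continuous function, denoted $f\oplus g$. Put $f\ominus g=f\oplus(-1)g$, where $((-1)g)(x)=\{-y: y\in g(x)\}$. *)

(* Defs.v *)
From mathcomp Require Import all_boot all_order all_algebra.
From mathcomp Require Import all_classical all_reals all_analysis.
Set Implicit Arguments.
Unset Strict Implicit.
Unset Printing Implicit Defensive.
Import Order.TTheory GRing.Theory Num.Theory.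
Import numFieldNormedType.Exports.
Local Open Scope classical_set_scope.
Local Open Scope ring_scope.

(* Extended real intervals are represented by the sets of their points, and
   interval functions by maps into [set \bar R] all of whose values are
   intervals. *)
Definition ext_interval (R : realType) (A : set \bar R) : Prop :=
  exists a b : \bar R, (a <= b)%E /\ A = `[a, b]%classic.

Definition interval_fun (R : realType) (X : Type) (f : X -> set \bar R) : Prop :=
  forall x, ext_interval (f x).

Definition itv_graph (R : realType) (X : Type) (f : X -> set \bar R) :
    set (X * \bar R) :=
  [set p | f p.1 p.2].

Definition S_continuous (R : realType) (X : topologicalType)
    (f : X -> set \bar R) : Prop :=
  interval_fun f /\ closed (itv_graph f).

Definition itv_sub (R : realType) (X : Type) (phi f : X -> set \bar R) : Prop :=
  forall x, phi x `<=` f x.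

Definition H_continuous (R : realType) (X : topologicalType)
    (f : X -> set \bar R) : Prop :=
  S_continuous f /\
  forall phi : X -> set \bar R, S_continuous phi -> itv_sub phi f -> phi = f.

Definition Gamma (R : realType) (X : Type) (f : X -> set \bar R) : set X :=
  [set x | f x -oo%E \/ f x +oo%E].

Definition nowhere_dense (X : topologicalType) (A : set X) : Prop :=
  interior (closure A) = set0.

Definition nearly_finite (R : realType) (X : topologicalType)
    (f : X -> set \bar R) : Prop :=
  closed (Gamma f) /\ nowhere_dense (Gamma f).

Definition Hnf (R : realType) (X : topologicalType) : Type :=
  {f : X -> set \bar R | H_continuous f /\ nearly_finite f}.

(* Set-valued because the library's total addition gives -oo + +oo = -oo,
   whereas here the sum of opposite infinities is the whole of [-oo, +oo]. *)
Definition ext_add (R : realType) (a b : \bar R) : set \bar R :=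
  match a, b with
  | -oo%E, +oo%E | +oo%E, -oo%E => [set: \bar R]
  | _, _ => [set (a + b)%E]
  end.

Definition itv_add (R : realType) (A B : set \bar R) : set \bar R :=
  [set c | exists a b, [/\ A a, B b & ext_add a b c]].

Definition fun_add (R : realType) (X : Type) (f g : X -> set \bar R) :
    X -> set \bar R :=
  fun x => itv_add (f x) (g x).

Definition fun_opp (R : realType) (X : Type) (g : X -> set \bar R) :
    X -> set \bar R :=
  fun x => [set (- y)%E | y in g x].

(* The H-continuous function contained in the point-wise sum.  It exists and is
   unique when f and g are nearly finite and H-continuous, so the default value
   given to [xget] plays no role there. *)
Definition oplus (R : realType) (X : topologicalType)
    (f g : X -> set \bar R) : X -> set \bar R :=
  xget (fun=> set0) [set h | H_continuous h /\ itv_sub h (fun_add f g)].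

Definition ominus (R : realType) (X : topologicalType)
    (f g : X -> set \bar R) : X -> set \bar R :=
  oplus f (fun_opp g).

(* The infimum and supremum of a set [a, b] with a <= b are its endpoints. *)
Definition modulus (R : realType) (A : set \bar R) : \bar R :=
  Order.max `|ereal_inf A|%E `|ereal_sup A|%E.

(* Off Gamma f and Gamma g the value of f - g is an interval with finite
   endpoints, so [fine] loses nothing.  The real supremum of the empty set is 0,
   which gives rho = 0 on the empty space. *)
Definition rho (R : realType) (X : topologicalType) (f g : Hnf R X) : R :=
  sup [set (let m := fine (modulus (ominus (sval f) (sval g) x)) in
            m / (1 + m))
      | x in ~` (Gamma (sval f) `|` Gamma (sval g))].

Definition complete_metric (R : realType) (T : Type) (d : T -> T -> R) : Prop :=
  exists c : Metric.axioms_ R T,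
    let M : metricType R := Metric.Pack c in
    (forall x y : M, mdist x y = d x y) /\
    (forall u : nat -> M, cauchy (u @ \oo) -> exists l : M, u @ \oo --> l).

(* Main.v *)
Require Import Defs.
From HB Require Import structures.
From mathcomp Require Import all_boot all_order all_algebra.
From mathcomp Require Import all_classical all_reals all_analysis.
From mathcomp Require Import ring lra.
Set Implicit Arguments.
Unset Strict Implicit.
Unset Printing Implicit Defensive.
Import Order.TTheory GRing.Theory Num.Theory.
Import numFieldNormedType.Exports.
Local Open Scope classical_set_scope.
Local Open Scope ring_scope.
Local Open Scope ereal_scope.

(** An S-continuous function is an interval [[l, u]] with [l] lower and [u] upper
    semicontinuous, because the extended line is compact Hausdorff.  It is
    H-continuous exactly when each bound is determined by the other: on an open
    set, a lower semicontinuous minorant of [u] is a minorant of [l]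
    ([H_lower_ge]), and dually ([H_upper_le]); otherwise the bound could be moved
    and the function would not be minimal.

    The theorem rests on a description of [rho] that mentions neither the
    difference nor the infinite values: for [e >= 0],
    [rho F G <= e / (1 + e)] if and only if [lo F <= up G + e] and
    [lo G <= up F + e] at every point, that is, [F x] and [G x] come within [e]
    of each other everywhere ([rho_uniformly_close]).  Both inequalities compare a
    lower with an upper semicontinuous function, so they define closed sets, and
    it suffices to check them off the closed nowhere dense set of infinite
    values, where they follow from
    [lo F - up G <= ominus F G <= up F - lo G].  Conversely, if the difference
    [h] exceeded [e] somewhere it would exceed some [r > e] on an open set; there
    [lo G + r <= up F], hence [up G + r <= up F] by [H_upper_le], against
    [up F <= up G + e].

    By H-continuity, closeness is equivalent to the stronger
    [lo F <= lo G + e] and [up F <= up G + e] ([uniformly_close_lo],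
    [uniformly_close_up]).  So closeness constants add up, which
    is the triangle inequality since [e / (1 + e)] is subadditive, and constant 0
    forces equality.  A Cauchy sequence is one whose two bounds are uniformly
    Cauchy; the uniform limits of the bounds again form an H-continuous function
    ([uniform_limit_H_continuous]), and it is infinite only where a late
    term of the sequence is, so it is nearly finite. *)

(** * The extended real line *)

Section ExtendedReals.
Context {R : realType}.
Implicit Types (a b : \bar R).

(** The extended line is the image of [[-1, 1]] under [expand], whose inverse
    defines the distance on it. *)
Lemma ereal_compact : compact [set: \bar R].
Proof.
have -> : [set: \bar R] = @expand R @` `[(- 1)%R, 1%R].
  apply/seteqP; split => // y _; exists (contract y); last exact: contractK.
  by rewrite /= in_itv /= -ler_norml; exact: contract_le1.
apply: continuous_compact; last exact: segment_compact.
apply/subspace_continuousP => x; rewrite /= in_itv /= -ler_norml => x1.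
apply/cvg_ballP => e e0; rewrite near_withinE.
apply: filterS (nbhsx_ballx x e e0) => y /= xy.
rewrite in_itv /= -ler_norml => y1.
by rewrite /ball /= /ereal_ball !expandK ?inE.
Qed.

Lemma ereal_between a b : a < b -> exists r : R, a < r%:E < b.
Proof.
move=> ab; set m := ((contract a + contract b) / 2)%R.
have [am mb] : (contract a < m)%R /\ (m < contract b)%R.
  by have [] := midf_lt (etrans (lt_contract a b) ab).
have m1 : (`|m| < 1)%R.
  move: (contract_le1 a) (contract_le1 b); rewrite ler_norml ler_norml ltr_norml.
  move=> /andP[a1 _] /andP[_ b1].
  by rewrite (le_lt_trans a1 am) (lt_le_trans mb b1).
exists (fine (expand m)); rewrite fine_expand//.
rewrite -{1}(contractK a) -{1}(contractK b).
by rewrite !lt_expand ?am ?mb// inE ?contract_le1// ltW.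
Qed.

(** The sum on the left makes sense of a positive gap even when [a] is infinite;
    two copies of [e] leave room for approximating both [a] and [b]. *)
Lemma ereal_slack a b : a < b -> exists2 e : R, (0 < e)%R & a + e%:E + e%:E < b.
Proof.
move=> ab; apply: contrapT => noe; move: ab; rewrite ltNge => /negP; apply.
apply/lee_addgt0Pr => e e0; rewrite leNgt; apply/negP => aeb; apply: noe.
exists (e / 2)%R; first by rewrite divr_gt0.
by rewrite -addeA -EFinD -splitr.
Qed.

Lemma ereal_inf_itvcc a b : a <= b -> ereal_inf `[a, b] = a.
Proof.
move=> ab; apply/eqP; rewrite eq_le; apply/andP; split.
  by apply: ereal_inf_lbound => /=; rewrite in_itv /= lexx.
by apply: le_ereal_inf_tmp => y /=; rewrite in_itv /= => /andP[].
Qed.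

Lemma ereal_sup_itvcc a b : a <= b -> ereal_sup `[a, b] = b.
Proof.
move=> ab; apply/eqP; rewrite eq_le; apply/andP; split.
  by apply: ge_ereal_sup => y /=; rewrite in_itv /= => /andP[].
by apply: ereal_sup_ubound => /=; rewrite in_itv /= lexx andbT.
Qed.

End ExtendedReals.

(** * Semicontinuous functions *)

Local Notation lsc l := (lower_semicontinuous l).
Local Notation usc u := (lower_semicontinuous (fun x => - u x)).

Section Semicontinuity.
Context {R : realType} {X : topologicalType}.
Implicit Types (l u w : X -> \bar R) (W : set X).

Lemma lsc_open l a : lsc l -> open [set x | a < l x].
Proof.
move=> /lower_semicontinuousP lo; rewrite openE => x /= alx.
have [r /andP[ar rl]] := ereal_between alx.
apply: (@filterS _ _ _ [set y | r%:E < l y]) => [y /=|]; first exact: lt_trans.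
by apply: open_nbhs_nbhs; split => //; exact: lo.
Qed.

Lemma usc_open u a : usc u -> open [set x | u x < a].
Proof.
move=> uu; rewrite (_ : [set _ | _] = [set x | - a < - u x]); first exact: lsc_open.
by apply/seteqP; split => x /=; rewrite lteN2.
Qed.

Lemma usc_opp l : lsc l -> usc (fun x => - l x).
Proof. by move=> ll; rewrite (_ : (fun x => _) = l)//; apply/funext => x; rewrite oppeK. Qed.

(** Here opposite infinities sum to [-oo], which is the choice that keeps
    a sum of lower semicontinuous functions lower semicontinuous. *)
Lemma lscD l w : lsc l -> lsc w -> lsc (fun x => l x + w x).
Proof.
move=> ll lw x r rlw.
(* Real numbers below the summands whose sum still reaches [r]: if one summand is
   infinite, any real below the other one will do for that one. *)
have [a [b [al bw rab]]] : exists a b : R, [/\ a%:E < l x, b%:E < w x & (r <= a + b)%R].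
  case: (l x) (w x) rlw => [p| |] [q| |] //.
  - rewrite -EFinD lte_fin => rpq; pose e := ((p + q - r) / 2)%R.
    have e0 : (0 < e)%R by rewrite divr_gt0// subr_gt0.
    exists (p - e)%R, (q - e)%R; rewrite !lte_fin !ltrBlDr !ltrDl e0; split => //.
    by rewrite addrACA -opprD -splitr opprB addrC subrK.
  - exists (p - 1)%R, (r - (p - 1))%R; rewrite lte_fin ltrBlDr ltrDl ltry.
    by split => //; rewrite addrC subrK.
  - exists (r - (q - 1))%R, (q - 1)%R; rewrite lte_fin ltrBlDr ltrDl ltry.
    by split => //; rewrite subrK.
  - by exists r, 0%R; rewrite !ltry addr0.
exists ([set y | a%:E < l y] `&` [set y | b%:E < w y]).
  by apply: filterI; apply: open_nbhs_nbhs; split => //; exact: lsc_open.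
move=> y [/= aly bwy]; apply: (@le_lt_trans _ _ (a%:E + b%:E)).
  by rewrite -EFinD lee_fin.
exact: lteD.
Qed.

Lemma lsc_cst (c : \bar R) : lsc (fun _ : X => c).
Proof. by move=> x a ac; exists setT => //; exact: filterT. Qed.

(** Raising a lower semicontinuous function on an open set only keeps it lower
    semicontinuous: this is the modification that minimality forbids in
    [H_lower_ge]. *)
Lemma lsc_max_on W l w : open W -> lsc l -> lsc w ->
  lsc (fun x => if x \in W then maxe (l x) (w x) else l x).
Proof.
move=> oW ll lw; apply/lower_semicontinuousP => a.
rewrite (_ : [set _ | _] = [set x | a%:E < l x] `|` W `&` [set x | a%:E < w x]).
  by apply: openU; [exact: lsc_open | apply: openI => //; exact: lsc_open].
apply/seteqP; split => x /=; case: ifPn; rewrite ?inE ?notin_setE => Wx.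
- by rewrite lt_max => /orP[]; [left|right].
- by left.
- by rewrite lt_max => -[->//|[_ ->]]; rewrite orbT.
- by case=> // -[].
Qed.

Lemma lsc_uniform_limit l :
  (forall e : R, (0 < e)%R -> exists2 k, lsc k &
     forall x, k x <= l x + e%:E /\ l x <= k x + e%:E) ->
  lsc l.
Proof.
move=> kl x a /ereal_slack[e e0 ael].
have [k lk /all_and2[kle lke]] := kl e e0.
exists [set y | a%:E + e%:E < k y].
  apply: open_nbhs_nbhs; split; first exact: lsc_open.
  by move: (lt_le_trans ael (lke x)); rewrite /= lteD2rE.
by move=> y /= aeky; have := lt_le_trans aeky (kle y); rewrite lteD2rE.
Qed.

End Semicontinuity.

(** * Interval functions as pairs of semicontinuous bounds *)

Definition itvf {R : realType} {X : Type} (l u : X -> \bar R) : X -> set \bar R :=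
  fun x => `[l x, u x]%classic.

Definition lo {R : realType} {X : Type} (f : X -> set \bar R) (x : X) : \bar R :=
  ereal_inf (f x).

Definition up {R : realType} {X : Type} (f : X -> set \bar R) (x : X) : \bar R :=
  ereal_sup (f x).

Section IntervalFunctions.
Context {R : realType}.
Implicit Types (X : topologicalType).

Lemma itvfP {T : Type} (l u : T -> \bar R) x y : itvf l u x y <-> l x <= y <= u x.
Proof. by rewrite /itvf /= in_itv. Qed.

Lemma interval_fun_itvf {T : Type} (l u : T -> \bar R) :
  (forall x, l x <= u x) -> interval_fun (itvf l u).
Proof. by move=> lu x; exists (l x), (u x). Qed.

Lemma lo_itvf {T : Type} (l u : T -> \bar R) : (forall x, l x <= u x) -> lo (itvf l u) = l.
Proof. by move=> lu; apply/funext => x; rewrite /lo ereal_inf_itvcc. Qed.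

Lemma up_itvf {T : Type} (l u : T -> \bar R) : (forall x, l x <= u x) -> up (itvf l u) = u.
Proof. by move=> lu; apply/funext => x; rewrite /up ereal_sup_itvcc. Qed.

Lemma itvf_lo_up {T : Type} (f : T -> set \bar R) : interval_fun f -> f = itvf (lo f) (up f).
Proof.
move=> If; apply/funext => x; rewrite /itvf /lo /up.
by have [a [b [ab ->]]] := If x; rewrite ereal_inf_itvcc// ereal_sup_itvcc.
Qed.

Lemma lo_le_up {T : Type} (f : T -> set \bar R) x : interval_fun f -> lo f x <= up f x.
Proof.
move=> If; rewrite /lo /up.
by have [a [b [ab ->]]] := If x; rewrite ereal_inf_itvcc// ereal_sup_itvcc.
Qed.

Lemma lo_mem {T : Type} (f : T -> set \bar R) x : interval_fun f -> f x (lo f x).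
Proof. by move=> If; rewrite {1}(itvf_lo_up If) itvfP lexx lo_le_up. Qed.

Lemma up_mem {T : Type} (f : T -> set \bar R) x : interval_fun f -> f x (up f x).
Proof. by move=> If; rewrite {1}(itvf_lo_up If) itvfP lexx lo_le_up. Qed.

(** A tube argument: [K] is compact, so a point whose value misses [K] has a
    neighbourhood on which the closed graph stays off [K].  Taking for [K] a closed
    ray gives the semicontinuity of the bounds. *)
Lemma S_continuous_avoid X (f : X -> set \bar R) (K : set \bar R) :
  S_continuous f -> closed K -> open [set x | forall y, f x y -> ~ K y].
Proof.
move=> [_ clf] clK.
have /compact_near_coveringP cptK : compact K.
  exact: (subclosed_compact clK ereal_compact).
rewrite openE => x /= fxK.
have cover y : K y -> \forall y' \near y & x' \near x, ~ f x' y'.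
  move=> Ky; have : nbhs (x, y) (~` itv_graph f).
    apply: open_nbhs_nbhs; split; first by rewrite openC.
    by move=> fxy; exact: fxK fxy Ky.
  move=> [[A B] [Ax By] AB]; exists (B, A) => // -[y' x'] [By' Ax'] fxy.
  exact: (AB (x', y')).
rewrite /interior /=.
apply: filterS (cptK _ _ (fun x' y' => ~ f x' y') _ cover) => x' Kf y fy Ky.
exact: Kf y Ky fy.
Qed.

Lemma S_continuous_lsc X (f : X -> set \bar R) : S_continuous f -> lsc (lo f).
Proof.
move=> Sf; apply/lower_semicontinuousP => a; have [If _] := Sf.
have := S_continuous_avoid Sf (@closed_ereal_ge_ereal _ a%:E).
congr open; apply/seteqP; split => x /= H.
  by rewrite ltNge; apply/negP; apply: H; exact: lo_mem.
move=> y fy; apply/negP; rewrite -ltNge (lt_le_trans H)//.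
exact: ereal_inf_lbound.
Qed.

Lemma S_continuous_usc X (f : X -> set \bar R) : S_continuous f -> usc (up f).
Proof.
move=> Sf; apply/lower_semicontinuousP => a; have [If _] := Sf.
have := S_continuous_avoid Sf (@closed_ereal_le_ereal _ (- a%:E)).
congr open; apply/seteqP; split => x /= H.
  by rewrite lteNr ltNge; apply/negP; apply: H; exact: up_mem.
move=> y fy; apply/negP; rewrite -ltNge; move: H; rewrite lteNr; apply: le_lt_trans.
exact: ereal_sup_ubound.
Qed.

(** A value strictly outside [[l x, u x]] is separated from it by a real number,
    and semicontinuity keeps it separated nearby. *)
Lemma S_continuous_itvf X (l u : X -> \bar R) :
  lsc l -> usc u -> (forall x, l x <= u x) -> S_continuous (itvf l u).
Proof.
move=> ll uu lu; split; first exact: interval_fun_itvf.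
rewrite -openC openE => -[x y] /=.
rewrite /itv_graph /= itvfP => /negP; rewrite negb_and -!ltNge => /orP[yl|uy].
- have [c /andP[yc cl]] := ereal_between yl.
  exists ([set x | c%:E < l x], [set y | y < c%:E]).
    split; apply: open_nbhs_nbhs; split => //; first exact: lsc_open.
    exact: open_ereal_lt_ereal.
  move=> [x' y'] /= [cl' yc'] /andP[+ _]; apply/negP; rewrite -ltNge.
  exact: lt_trans cl'.
- have [c /andP[uc cy]] := ereal_between uy.
  exists ([set x | u x < c%:E], [set y | c%:E < y]).
    split; apply: open_nbhs_nbhs; split => //; first exact: usc_open.
    exact: open_ereal_gt_ereal.
  move=> [x' y'] /= [cl' yc'] /andP[_]; apply/negP; rewrite -ltNge.
  exact: lt_trans cl' _.
Qed.

End IntervalFunctions.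

(** * Hausdorff continuous functions *)

Section Opposite.
Context {R : realType}.
Implicit Types (X : topologicalType).

Lemma fun_oppK {T : Type} : involutive (@fun_opp R T).
Proof.
move=> f; apply/funext => x; rewrite /fun_opp image_comp.
by rewrite (_ : _ \o _ = id) ?image_id//; apply/funext => y /=; rewrite oppeK.
Qed.

Lemma lo_fun_opp {T : Type} (f : T -> set \bar R) x : lo (fun_opp f) x = - up f x.
Proof. exact: ereal_infN. Qed.

Lemma up_fun_opp {T : Type} (f : T -> set \bar R) x : up (fun_opp f) x = - lo f x.
Proof. exact: ereal_supN. Qed.

Lemma itv_sub_fun_opp {T : Type} (f g : T -> set \bar R) :
  itv_sub f g -> itv_sub (fun_opp f) (fun_opp g).
Proof. by move=> fg x; apply: image_subset. Qed.

Lemma fun_opp_itvf {T : Type} (l u : T -> \bar R) :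
  fun_opp (itvf l u) = itvf (fun x => - u x) (fun x => - l x).
Proof.
apply/funext => x; apply/seteqP; split => [_ [y /itvfP /andP[ly yu] <-]|y].
  by apply/itvfP; rewrite !leeN2 ly yu.
move=> /itvfP /andP[uy yl]; exists (- y); last exact: oppeK.
by apply/itvfP; rewrite leeNr yl leeNl uy.
Qed.

Lemma S_continuous_opp X (f : X -> set \bar R) :
  S_continuous f -> S_continuous (fun_opp f).
Proof.
move=> Sf; have [If _] := Sf; rewrite (itvf_lo_up If) fun_opp_itvf.
apply: S_continuous_itvf; first exact: S_continuous_usc.
  by apply: usc_opp; exact: S_continuous_lsc.
by move=> x; rewrite leeN2 lo_le_up.
Qed.

(** Negation exchanges the two bounds; it turns each statement on lower bounds into
    one on upper bounds. *)
Lemma H_continuous_opp X (f : X -> set \bar R) :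
  H_continuous f -> H_continuous (fun_opp f).
Proof.
move=> [Sf minf]; split; first exact: S_continuous_opp.
move=> phi Sphi /itv_sub_fun_opp; rewrite fun_oppK => phif.
by rewrite -(minf _ (S_continuous_opp Sphi) phif) fun_oppK.
Qed.

End Opposite.

Section HausdorffContinuity.
Context {R : realType} {X : topologicalType}.
Implicit Types (f g h : X -> set \bar R) (W : set X) (l u v w : X -> \bar R).

(** Replacing [lo f] by its maximum with [w] on [W] yields a smaller S-continuous
    function, which minimality identifies with [f]. *)
Lemma H_lower_ge f W w : H_continuous f -> open W -> lsc w ->
  (forall x, W x -> w x <= up f x) -> forall x, W x -> w x <= lo f x.
Proof.
move=> [Sf minf] oW lw wf x Wx; have [If _] := Sf.
pose l x := if x \in W then maxe (lo f x) (w x) else lo f x.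
have lf : l x = lo f x.
  rewrite -(minf (itvf l (up f))).
  - rewrite lo_itvf// => y; rewrite /l; case: ifPn => [/set_mem Wy|_].
      by rewrite ge_max lo_le_up//= wf.
    exact: lo_le_up.
  - apply: S_continuous_itvf.
    + by apply: lsc_max_on => //; exact: S_continuous_lsc.
    + exact: S_continuous_usc.
    + move=> y; rewrite /l; case: ifPn => [/set_mem Wy|_].
        by rewrite ge_max lo_le_up//= wf.
      exact: lo_le_up.
  - move=> y z /itvfP /andP[lz zu]; rewrite (itvf_lo_up If); apply/itvfP.
    rewrite zu andbT (le_trans _ lz)// /l; case: ifPn => _ //.
    by rewrite le_max lexx.
by rewrite -lf /l mem_set// le_max lexx orbT.
Qed.

Lemma H_upper_le f W v : H_continuous f -> open W -> usc v ->
  (forall x, W x -> lo f x <= v x) -> forall x, W x -> up f x <= v x.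
Proof.
move=> Hf oW uv fv x Wx.
have := @H_lower_ge (fun_opp f) W (fun x => - v x) (H_continuous_opp Hf) oW uv.
move=> /(_ _ x Wx); rewrite lo_fun_opp leeN2; apply => y Wy.
by rewrite up_fun_opp leeN2 fv.
Qed.

(** The converse of the two previous lemmas, where constant comparison functions
    are enough: if a smaller function had a larger lower bound at [x], a real
    number [c] between the two bounds would violate the first condition on the
    open set where the larger one exceeds [c]. *)
Lemma H_continuous_itvf l u : lsc l -> usc u -> (forall x, l x <= u x) ->
  (forall W c, open W -> (forall x, W x -> c <= u x) -> forall x, W x -> c <= l x) ->
  (forall W c, open W -> (forall x, W x -> l x <= c) -> forall x, W x -> u x <= c) ->
  H_continuous (itvf l u).
Proof.
move=> ll uu lu lP uP; split; first exact: S_continuous_itvf.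
move=> phi Sphi phis; have [Iphi _] := Sphi.
have lphi x : l x <= lo phi x by have /phis/itvfP/andP[] := lo_mem x Iphi.
have phiu x : up phi x <= u x by have /phis/itvfP/andP[] := up_mem x Iphi.
rewrite (itvf_lo_up Iphi); congr itvf; apply/funext => x; apply/eqP; rewrite eq_le.
  rewrite lphi andbT leNgt; apply/negP => /ereal_between[c /andP[lc cphi]].
  move: lc; rewrite ltNge => /negP; apply.
  apply: (lP [set y | c%:E < lo phi y]) => //.
    by apply: lsc_open; exact: S_continuous_lsc.
  move=> y /= /ltW cy; rewrite (le_trans cy)// (le_trans _ (phiu y))//.
  exact: lo_le_up.
rewrite phiu /= leNgt; apply/negP => /ereal_between[c /andP[phic cu]].
move: cu; rewrite ltNge => /negP; apply.
apply: (uP [set y | up phi y < c%:E]) => //.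
  by apply: usc_open; exact: S_continuous_usc.
move=> y /= /ltW yc; rewrite (le_trans (lphi y))// (le_trans _ yc)//.
exact: lo_le_up.
Qed.

(** The largest lower semicontinuous minorant of [v] (the lower Baire function). *)
Definition lower_envelope v x : \bar R :=
  ereal_sup [set c | exists2 W, open_nbhs x W & forall y, W y -> c <= v y].

Definition upper_envelope v x : \bar R := - lower_envelope (fun y => - v y) x.

Lemma lower_envelope_ge W v c : open W -> (forall x, W x -> c <= v x) ->
  forall x, W x -> c <= lower_envelope v x.
Proof. by move=> oW cv x Wx; apply: ereal_sup_ubound; exists W. Qed.

Lemma upper_envelope_le W v c : open W -> (forall x, W x -> v x <= c) ->
  forall x, W x -> upper_envelope v x <= c.
Proof.
move=> oW vc x Wx; rewrite leeNl.
by apply: (lower_envelope_ge oW) => // y Wy; rewrite leeN2 vc.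
Qed.

Lemma lower_envelope_le v x : lower_envelope v x <= v x.
Proof. by apply: ge_ereal_sup => c [W [_ Wx]]; apply. Qed.

Lemma upper_envelope_ge v x : v x <= upper_envelope v x.
Proof. by rewrite leeNr lower_envelope_le. Qed.

Lemma lsc_lower_envelope v : lsc (lower_envelope v).
Proof.
move=> x a /ereal_sup_gt[c [W [oW Wx] cv] ac].
exists W; first exact: open_nbhs_nbhs.
by move=> y Wy; rewrite (lt_le_trans ac)//; exact: (lower_envelope_ge oW).
Qed.

Lemma usc_upper_envelope v : usc (upper_envelope v).
Proof. by apply: usc_opp; exact: lsc_lower_envelope. Qed.

Lemma lower_envelope_max l v : lsc l -> (forall x, l x <= v x) ->
  forall x, l x <= lower_envelope v x.
Proof.
move=> ll lv x; rewrite leNgt; apply/negP => /ereal_between[c /andP[vc cl]].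
move: vc; rewrite ltNge => /negP; apply.
apply: (@lower_envelope_ge [set y | c%:E < l y]) => //; first exact: lsc_open.
by move=> y /= /ltW cly; rewrite (le_trans cly).
Qed.

Lemma upper_envelope_min u v : usc u -> (forall x, v x <= u x) ->
  forall x, upper_envelope v x <= u x.
Proof.
move=> uu vu x; rewrite leeNl.
by apply: (@lower_envelope_max (fun y => - u y)) => // y; rewrite leeN2.
Qed.

(** The lower bound of [h] is the lower envelope of the upper envelope of [l], and
    its upper bound is the upper envelope of that; each is then determined by the
    other, as alternating the two envelopes stabilizes after two steps. *)
Lemma exists_H_continuous l u : lsc l -> usc u -> (forall x, l x <= u x) ->
  exists2 h, H_continuous h & itv_sub h (itvf l u).
Proof.
move=> ll uu lu; pose l1 := lower_envelope (upper_envelope l).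
pose u1 := upper_envelope l1.
have l1l x : l1 x <= upper_envelope l x by exact: lower_envelope_le.
have u1l x : u1 x <= upper_envelope l x.
  by apply: upper_envelope_min => //; exact: usc_upper_envelope.
exists (itvf l1 u1).
  apply: H_continuous_itvf.
  - exact: lsc_lower_envelope.
  - exact: usc_upper_envelope.
  - exact: upper_envelope_ge.
  - move=> W c oW cu; apply: lower_envelope_ge => // x Wx.
    by rewrite (le_trans (cu x Wx)).
  - by move=> W c; exact: upper_envelope_le.
move=> x y /itvfP /andP[l1y yu1]; apply/itvfP; apply/andP; split.
  by rewrite (le_trans _ l1y)//; apply: lower_envelope_max => // z; exact: upper_envelope_ge.
rewrite (le_trans yu1)// (le_trans (u1l x))//; exact: upper_envelope_min.
Qed.

End HausdorffContinuity.

(** * The difference of two functions *)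

Section Difference.
Context {R : realType} {X : topologicalType}.
Implicit Types (f g h : X -> set \bar R).

(** The right-hand side is [a' + b'] with opposite infinities summing to [+oo]
    instead of [-oo]: the two sides are the ends of the interval sum of [[a, a']]
    and [[b, b']]. *)
Lemma adde_le_dual (a a' b b' : \bar R) :
  a <= a' -> b <= b' -> a + b <= - (- a' - b').
Proof.
move=> aa bb; have [ab|] := boolP (a +? b).
  by rewrite leeNr oppeD// leeD ?leeN2.
by case: a aa => [?| |]; case: b bb => [?| |] //= _ _ _; rewrite leNye.
Qed.

(** Without opposite infinities, [c] is reached by moving one summand while the
    other stays at an end of its interval; the case analysis serves to subtract only
    finite quantities. *)
Lemma ext_add_surj (a a' m n c : \bar R) : a <= a' -> m <= n ->
  a + m <= c -> c <= - (- a' - n) ->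
  exists p q, [/\ a <= p <= a', m <= q <= n & ext_add p q c].
Proof.
move=> aa mn amc can.
have [[a_Ny n_y]|nopp1] := pselect (a = -oo /\ n = +oo).
  by exists -oo, +oo; split; rewrite ?a_Ny ?n_y ?leNye ?leey.
have [[a'_y m_Ny]|nopp2] := pselect (a' = +oo /\ m = -oo).
  by exists +oo, -oo; split; rewrite ?a'_y ?m_Ny ?leNye ?leey.
have addBK (x y : \bar R) : y \is a fin_num -> ext_add (x - y) y x /\ ext_add y (x - y) x.
  by case: x y => [x| |] [y| |] //= _; rewrite -EFinB -!EFinD subrK addrC subrK.
have [nfin|ninf] := boolP (n \is a fin_num).
  rewrite fin_num_oppeB// oppeK in can.
  have [acn|acn] := leP a (c - n).
    exists (c - n), n; rewrite acn mn lexx leeBlDr// can; split => //.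
    by have [] := addBK c n nfin.
  have [afin|ainf] := boolP (a \is a fin_num).
    exists a, (c - a); rewrite lexx aa leeBrDl// amc; split => //.
      by rewrite leeBlDl// ltW// -lteBlDr.
    by have [] := addBK c a afin.
  case: a ainf aa amc nopp1 acn => [a| |]// _; last by move=> _ _ _; rewrite ltNge leNye.
  rewrite leye_eq => /eqP a'y amc _ cny; exfalso.
  have mr : m != -oo by apply/eqP => mNy; case: nopp2.
  have cy : c = +oo by apply/eqP; rewrite -leye_eq (le_trans _ amc)//; case: m mr {mn amc nopp2}.
  by move: cny; rewrite cy; case: n nfin {mn can}.
have [afin|ainf] := boolP (a \is a fin_num).
  exists a, (c - a); rewrite lexx aa leeBrDl// amc; split => //; last by have [] := addBK c a afin.
  case: n ninf mn can {nopp1} => [n| |]// _; first by move=> *; rewrite leey.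
  rewrite leeNy_eq => /eqP mNy.
  case: a' aa nopp2 => [a'| |]// aa nopp2; last by case: a afin aa {amc}.
  - by rewrite leeNy_eq => /eqP ->; case: a afin {aa amc}.
  - by case: nopp2.
case: n ninf mn can nopp1 => [n| |]// _ mn can nopp1.
- case: a ainf aa amc nopp1 => [a| |]// _ aa amc nopp1; last by case: nopp1.
  exists +oo, m; rewrite aa lexx mn; split => //.
  have my : m != -oo.
    by apply/eqP => mNy; case: nopp2; split => //; apply/eqP; rewrite -leye_eq.
  have -> : c = +oo by apply/eqP; rewrite -leye_eq (le_trans _ amc)//; case: m my {mn amc nopp2}.
  by case: m my {mn amc nopp2}.
- move: mn nopp2; rewrite leeNy_eq => /eqP mNy nopp2; subst m.
  have a'y : a' != +oo by apply/eqP => a'y; case: nopp2.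
  have -> : c = -oo.
    by apply/eqP; rewrite -leeNy_eq (le_trans can)//; case: a' a'y {aa can nopp2}.
  exists a', -oo; rewrite aa lexx; split => //.
  by case: a' a'y {aa can nopp2}.
Qed.

(** The bounds of the point-wise difference are semicontinuous, so that
    [exists_H_continuous] provides a function inside it. *)
Lemma ominusP f g : S_continuous f -> S_continuous g ->
  H_continuous (ominus f g) /\ itv_sub (ominus f g) (fun_add f (fun_opp g)).
Proof.
move=> Sf Sg; apply: (@xgetPex _ (fun=> set0)
  [set h | H_continuous h /\ itv_sub h (fun_add f (fun_opp g))]).
have Sg' := S_continuous_opp Sg.
have [If _] := Sf; have [Ig _] := Sg'.
have [h Hh hs] := @exists_H_continuous R X
  (fun x => lo f x + lo (fun_opp g) x)
  (fun x => - (- up f x - up (fun_opp g) x))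
  (lscD (S_continuous_lsc Sf) (S_continuous_lsc Sg'))
  (usc_opp (lscD (S_continuous_usc Sf) (S_continuous_usc Sg')))
  (fun x => adde_le_dual (lo_le_up x If) (lo_le_up x Ig)).
exists h; split=> // x c /hs /itvfP /andP[lc cu].
have [p [q [fp gq pqc]]] :=
  ext_add_surj (lo_le_up x If) (lo_le_up x Ig) lc cu.
exists p, q; split => //; first by rewrite (itvf_lo_up If); exact/itvfP.
by rewrite (itvf_lo_up Ig); exact/itvfP.
Qed.

End Difference.

(** * Uniform closeness *)

Section Closeness.
Context {R : realType} {X : topologicalType}.
Implicit Types (f g h : X -> set \bar R) (e : R) (D : set X).

(** That is, the distance between the intervals [f x] and [g x] is at most [e] at
    each [x], with equal infinities at distance 0.  The comparison of a lower with
    an upper bound makes this a closed condition on [x], which a comparison of two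
    lower bounds would not be. *)
Definition uniformly_close e f g : Prop :=
  forall x, lo f x <= up g x + e%:E /\ lo g x <= up f x + e%:E.

Lemma uniformly_close_sym e f g : uniformly_close e f g -> uniformly_close e g f.
Proof. by move=> fg x; have [] := fg x. Qed.

Lemma H_interval_fun f : H_continuous f -> interval_fun f.
Proof. by case=> -[]. Qed.

Lemma H_lsc f : H_continuous f -> lsc (lo f).
Proof. by case=> Sf _; exact: S_continuous_lsc. Qed.

Lemma H_usc f : H_continuous f -> usc (up f).
Proof. by case=> Sf _; exact: S_continuous_usc. Qed.

Lemma lsc_addr (l : X -> \bar R) e : lsc l -> lsc (fun x => l x + e%:E).
Proof. by move=> ll; apply: lscD => //; exact: lsc_cst. Qed.

Lemma usc_addr (u : X -> \bar R) e : usc u -> usc (fun x => u x + e%:E).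
Proof.
move=> uu; rewrite (_ : (fun x => _) = (fun x => - u x + (- e)%:E)).
  exact: lsc_addr.
by apply/funext => x; rewrite fin_num_oppeD.
Qed.

(** [lo f - e] is a lower semicontinuous minorant of [up g], hence of [lo g]. *)
Lemma uniformly_close_lo e f g x : H_continuous f -> H_continuous g ->
  uniformly_close e f g -> lo f x <= lo g x + e%:E.
Proof.
move=> Hf Hg fg; rewrite -leeBlDr//.
apply: (@H_lower_ge _ _ g setT (fun x => lo f x + (- e)%:E)) => //.
- exact: openT.
- by apply: lsc_addr; exact: H_lsc.
- by move=> y _; rewrite EFinN leeBlDr//; have [] := fg y.
Qed.

Lemma uniformly_close_up e f g x : H_continuous f -> H_continuous g ->
  uniformly_close e f g -> up f x <= up g x + e%:E.
Proof.
move=> Hf Hg fg.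
apply: (@H_upper_le _ _ f setT (fun x => up g x + e%:E)) => //.
- exact: openT.
- by apply: usc_addr; exact: H_usc.
- by move=> y _; have [] := fg y.
Qed.

Lemma uniformly_closexx f : interval_fun f -> uniformly_close 0 f f.
Proof. by move=> If x; rewrite adde0 lo_le_up. Qed.

Lemma uniformly_close_trans e1 e2 g f h :
  H_continuous f -> H_continuous g -> H_continuous h ->
  uniformly_close e1 f g -> uniformly_close e2 g h -> uniformly_close (e1 + e2) f h.
Proof.
move=> Hf Hg Hh fg gh x; have [gh1 _] := gh x; have [_ fg2] := fg x.
split.
  by rewrite (le_trans (uniformly_close_lo x Hf Hg fg))// EFinD addeA addeAC leeD2r.
have := uniformly_close_lo x Hh Hg (uniformly_close_sym gh).
by move/le_trans; apply; rewrite EFinD addeA leeD2r.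
Qed.

Lemma uniformly_close0_eq f g : H_continuous f -> H_continuous g ->
  uniformly_close 0 f g -> f = g.
Proof.
move=> Hf Hg fg; have gf := uniformly_close_sym fg.
rewrite (itvf_lo_up (H_interval_fun Hf)) (itvf_lo_up (H_interval_fun Hg)).
congr itvf; apply/funext => x; apply/eqP; rewrite eq_le.
  by move: (uniformly_close_lo x Hf Hg fg) (uniformly_close_lo x Hg Hf gf);
    rewrite !adde0 => -> ->.
by move: (uniformly_close_up x Hf Hg fg) (uniformly_close_up x Hg Hf gf);
    rewrite !adde0 => -> ->.
Qed.

(** The set where the inequality fails is open, being defined by a lower and an
    upper semicontinuous function. *)
Lemma dense_lo_le_up e f g D : H_continuous f -> H_continuous g -> dense D ->
  (forall x, D x -> lo f x <= up g x + e%:E) -> forall x, lo f x <= up g x + e%:E.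
Proof.
move=> Hf Hg dD fgD x; rewrite leNgt; apply/negP => /ereal_between[c /andP[gc cf]].
have [] := dD ([set y | up g y + e%:E < c%:E] `&` [set y | c%:E < lo f y]).
- by exists x.
- by apply: openI; [apply: usc_open; apply: usc_addr; exact: H_usc
                   | apply: lsc_open; exact: H_lsc].
move=> y [[/= gcy cfy] Dy].
by have := le_lt_trans (fgD y Dy) (lt_trans gcy cfy); rewrite ltxx.
Qed.

(** The function [h] stands for the difference of [f] and [g].  If [up h] exceeded
    [e] at a point of [D], so would [lo h], by H-continuity; [lo h] would then
    exceed some [r > e] on an open set, where [lo g + r <= up f] improves to
    [up g + r <= up f]. *)
Lemma H_difference_le e f g h D : H_continuous f -> H_continuous g -> H_continuous h ->
  open D ->
  (forall x, D x -> [/\ lo g x \is a fin_num, up g x \is a fin_num,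
     lo h x <= up f x - lo g x & up f x <= up g x + e%:E]) ->
  forall x, D x -> up h x <= e%:E.
Proof.
move=> Hf Hg Hh oD DP.
apply: (@H_upper_le _ _ h D (fun=> e%:E)) => //.
  exact: (@lsc_cst _ _ (- e%:E)).
move=> x Dx; rewrite leNgt; apply/negP => /ereal_between[r /andP[er rh]].
have gf : forall y, ([set y | r%:E < lo h y] `&` D) y -> up g y <= up f y + (- r)%:E.
  apply: H_upper_le => //.
  - by apply: openI => //; apply: lsc_open; exact: H_lsc.
  - by apply: usc_addr; exact: H_usc.
  move=> y [/= /ltW rhy Dy]; have [gfin _ hfg _] := DP y Dy.
  by rewrite EFinN leeBrDr// addeC -leeBrDr// (le_trans rhy).
have [_ gfin _ fg] := DP x Dx; have := gf x (conj rh Dx).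
rewrite EFinN leeBrDr// => /le_trans/(_ fg); rewrite leeD2lE// leNgt.
by rewrite er.
Qed.

End Closeness.

(** * Infinite values and bounds for the difference *)

Section NearlyFinite.
Context {R : realType} {X : topologicalType}.
Implicit Types (f g h : X -> set \bar R) (F G H : Hnf R X) (e : R).

Lemma dense_setC_nowhere_dense (A : set X) : closed A -> nowhere_dense A ->
  open (~` A) /\ dense (~` A).
Proof.
move=> cA; rewrite /nowhere_dense -(closure_id A).1// => A0.
split; first by rewrite openC.
move=> U [x Ux] oU; apply: contrapT => /set0P/negP/negPn/eqP UA.
have : (interior A) x.
  rewrite /interior; apply: (@filterS _ _ _ U); last exact: open_nbhs_nbhs.
  by rewrite -(setCK A); exact/disjoints_subset.
by rewrite A0.
Qed.

Lemma Gamma_open_dense F G :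
  open (~` (Gamma (sval F) `|` Gamma (sval G))) /\
  dense (~` (Gamma (sval F) `|` Gamma (sval G))).
Proof.
have [_ [cF dF]] := svalP F; have [_ [cG dG]] := svalP G.
have [oF dnF] := dense_setC_nowhere_dense cF dF.
have [oG dnG] := dense_setC_nowhere_dense cG dG.
by rewrite setCU; split; [exact: openI | exact: denseI].
Qed.

Lemma notin_Gamma f x : interval_fun f -> ~ Gamma f x ->
  lo f x \is a fin_num /\ up f x \is a fin_num.
Proof.
move=> If /not_orP[fNy fy].
have lNy : lo f x != -oo by apply/eqP => E; apply: fNy; rewrite -E; exact: lo_mem.
have uy : up f x != +oo by apply/eqP => E; apply: fy; rewrite -E; exact: up_mem.
have := lo_le_up x If.
by case: (lo f x) (up f x) lNy uy => [a| |] [b| |].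
Qed.

Lemma modulus_le h x e : interval_fun h ->
  modulus (h x) <= e%:E <-> (- e)%:E <= lo h x /\ up h x <= e%:E.
Proof.
move=> Ih; rewrite /modulus -/(lo h x) -/(up h x) ge_max; have := lo_le_up x Ih.
split.
  move=> /andP[le ue]; split; first by rewrite EFinN leeNl (le_trans _ le)// -abseN lee_abs.
  by rewrite (le_trans _ ue)// lee_abs.
have absle (y : \bar R) : (- e)%:E <= y -> y <= e%:E -> `|y| <= e%:E.
  by case: y => [y| |]//; rewrite !lee_fin => ? ?; rewrite ler_norml; apply/andP.
by move=> [le ue]; rewrite !absle// ?(le_trans le)// (le_trans _ ue).
Qed.

(** Off the infinite values both summands are finite, and the interval sum is the
    usual one. *)
Lemma ominus_bounds f g x : H_continuous f -> H_continuous g ->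
  ~ (Gamma f `|` Gamma g) x ->
  lo f x - up g x <= lo (ominus f g) x /\ up (ominus f g) x <= up f x - lo g x.
Proof.
move=> Hf Hg /not_orP[nf ng].
have If := H_interval_fun Hf; have Ig := H_interval_fun Hg.
have [Hh hfg] := ominusP Hf.1 Hg.1; have Ih := H_interval_fun Hh.
have [lf uf] := notin_Gamma If nf; have [lg ug] := notin_Gamma Ig ng.
have bnd c : ominus f g x c -> lo f x - up g x <= c <= up f x - lo g x.
  move=> /hfg[a [_ [fa [b gb <-] cab]]].
  have := fa; have := gb; rewrite {1}(itvf_lo_up If) {1}(itvf_lo_up Ig).
  move=> /itvfP/andP[lb bu] /itvfP/andP[la au].
  have -> : c = a - b.
    have af : a \is a fin_num by rewrite fin_numE; apply/andP; split; apply/eqP => E;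
      apply: nf; rewrite /Gamma /= -E; [left|right].
    by case: a af cab {fa la au} => // r _; case: b {gb lb bu}.
  by rewrite !leeB.
by split; [have /andP[] := bnd _ (lo_mem x Ih) | have /andP[] := bnd _ (up_mem x Ih)].
Qed.

End NearlyFinite.

(** * The metric *)

Local Open Scope ring_scope.

Section Rho.
Context {R : realType} {X : topologicalType}.
Implicit Types (F G H : Hnf R X) (e t : R).

Lemma Hnf_H F : H_continuous (sval F).
Proof. by have [] := svalP F. Qed.

Lemma ler_frac (a b : R) : 0 <= a -> 0 <= b ->
  (a / (1 + a) <= b / (1 + b)) = (a <= b).
Proof.
move=> a0 b0; have a1 : 0 < 1 + a by lra.
have b1 : 0 < 1 + b by lra.
rewrite ler_pdivrMr// mulrAC ler_pdivlMr// !mulrDr !mulr1 [b * a]mulrC.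
by rewrite lerD2r.
Qed.

Lemma frac_lt1 (a : R) : 0 <= a -> a / (1 + a) < 1.
Proof. by move=> a0; rewrite ltr_pdivrMr; lra. Qed.

Lemma frac_ge0 (a : R) : 0 <= a -> 0 <= a / (1 + a).
Proof. by move=> a0; rewrite divr_ge0//; lra. Qed.

(** Subadditivity of [e / (1 + e)]: the source of the triangle inequality. *)
Lemma fracD (a b : R) : 0 <= a -> 0 <= b ->
  (a + b) / (1 + (a + b)) <= a / (1 + a) + b / (1 + b).
Proof.
move=> a0 b0; rewrite [(a + b) / _]mulrDl.
by apply: lerD; apply: ler_wpM2l => //; rewrite lef_pV2 ?posrE; lra.
Qed.

Lemma frac_onto t : 0 <= t < 1 -> exists2 e, 0 <= e & t = e / (1 + e).
Proof.
move=> /andP[t0 t1]; exists (t / (1 - t)); first by rewrite divr_ge0//; lra.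
by field; apply/andP; split; apply/eqP; lra.
Qed.

Let dist_at F G x : R := fine (modulus (ominus (sval F) (sval G) x)).

Let off F G : set X := ~` (Gamma (sval F) `|` Gamma (sval G)).

Lemma modulus_ge0 (A : set \bar R) : (0 <= modulus A)%E.
Proof. by rewrite /modulus le_max abse_ge0. Qed.

Lemma dist_at_ge0 F G x : 0 <= dist_at F G x.
Proof. by apply: fine_ge0; exact: modulus_ge0. Qed.

Lemma ominus_H F G : H_continuous (ominus (sval F) (sval G)).
Proof. by have [] := ominusP (Hnf_H F).1 (Hnf_H G).1. Qed.

Lemma off_fin F G x : off F G x ->
  [/\ lo (sval F) x \is a fin_num, up (sval F) x \is a fin_num,
      lo (sval G) x \is a fin_num & up (sval G) x \is a fin_num].
Proof.
move=> /not_orP[nF nG].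
have [? ?] := notin_Gamma (H_interval_fun (Hnf_H F)) nF.
by have [? ?] := notin_Gamma (H_interval_fun (Hnf_H G)) nG.
Qed.

Lemma dist_at_le F G x e : off F G x -> dist_at F G x <= e <->
  ((- e)%:E <= lo (ominus (sval F) (sval G)) x /\
   up (ominus (sval F) (sval G)) x <= e%:E)%E.
Proof.
move=> oFG; set h := ominus _ _; have Ih : interval_fun h := H_interval_fun (ominus_H F G).
have [lF uF lG uG] := off_fin oFG.
have [lh uh] := ominus_bounds (Hnf_H F) (Hnf_H G) oFG; rewrite -/h in lh uh.
have mfin : modulus (h x) \is a fin_num.
  have lfu := lo_le_up x Ih.
  have lfin : lo h x \is a fin_num.
    rewrite fin_numElt (lt_le_trans _ lh) ?(le_lt_trans (le_trans lfu uh))//.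
      by rewrite ltey_eq fin_numB uF lG.
    by rewrite ltNye_eq fin_numB lF uG.
  have ufin : up h x \is a fin_num.
    rewrite fin_numElt (lt_le_trans _ lfu) ?(le_lt_trans uh)//.
      by rewrite ltey_eq fin_numB uF lG.
    by rewrite ltNye_eq lfin.
  by rewrite /modulus; case: leP => _; rewrite abse_fin_num.
by rewrite -modulus_le// -[X in (X <= _)%E]fineK.
Qed.

Lemma rho_has_sup F G : (exists x, off F G x) ->
  has_sup [set dist_at F G x / (1 + dist_at F G x) | x in off F G].
Proof.
move=> [x ox]; split; first by eexists; exists x.
exists 1 => _ [y _ <-]; exact/ltW/frac_lt1/dist_at_ge0.
Qed.

Lemma rho_leP F G t : 0 <= t ->
  rho F G <= t <-> forall x, off F G x -> dist_at F G x / (1 + dist_at F G x) <= t.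
Proof.
move=> t0; rewrite /rho -/(off F G); split=> [rt x ox|le_t].
  apply: le_trans rt; apply: ub_le_sup; last by exists x.
  by have [] := @rho_has_sup F G (ex_intro _ x ox).
have [->|/set0P A0] := eqVneq [set dist_at F G x / (1 + dist_at F G x) | x in off F G] set0.
  by rewrite sup0.
by apply: ge_sup => // _ [x ox <-]; exact: le_t.
Qed.

Lemma rho_le1 F G : rho F G <= 1.
Proof. by apply/rho_leP => // x _; exact/ltW/frac_lt1/dist_at_ge0. Qed.

Lemma rho_ge0 F G : 0 <= rho F G.
Proof.
have [[x ox]|no] := pselect (exists x, off F G x).
  apply: (@le_trans _ _ (dist_at F G x / (1 + dist_at F G x))).
    exact/frac_ge0/dist_at_ge0.
  by apply: ub_le_sup; [have [] := @rho_has_sup F G (ex_intro _ x ox)|exists x].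
rewrite /rho -/(off F G) (_ : off F G = set0) ?image_set0 ?sup0//.
by apply/seteqP; split => // x ox; case: no; exists x.
Qed.

(** The bounds of the difference [h] control both directions.  From [rho] to
    closeness, [-e <= lo h] and [up h <= e] compare [F] and [G] on a dense set.
    Conversely, [H_difference_le] is applied to [F], [G], [h] and to
    [G], [F], [- h]. *)
Lemma rho_uniformly_close F G e : 0 <= e ->
  rho F G <= e / (1 + e) <-> uniformly_close e (sval F) (sval G).
Proof.
move=> e0; have [[HF HG] Hh] := (Hnf_H F, Hnf_H G, ominus_H F G).
have [oD dD] := Gamma_open_dense F G.
have Ih := H_interval_fun Hh.
split.
  move=> /(rho_leP _ _ (frac_ge0 e0)) le_e.
  have bnd x : off F G x ->
      (lo (sval F) x <= up (sval G) x + e%:E /\ lo (sval G) x <= up (sval F) x + e%:E)%E.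
    move=> ox; have := le_e x ox; rewrite ler_frac ?dist_at_ge0// => /(dist_at_le e ox)[lh uh].
    have [lF uF lG uG] := off_fin ox.
    have [lh' uh'] := ominus_bounds HF HG ox.
    have lu := lo_le_up x Ih; split.
      by rewrite addeC -leeBlDr// (le_trans lh')// (le_trans lu).
    by rewrite -leeBlDr// addeC -EFinN -leeBrDr// (le_trans lh)// (le_trans lu).
  have [b1 b2] : (forall x, lo (sval F) x <= up (sval G) x + e%:E)%E /\
      (forall x, lo (sval G) x <= up (sval F) x + e%:E)%E.
    split; [apply: (dense_lo_le_up HF HG dD)|apply: (dense_lo_le_up HG HF dD)];
    by move=> x /bnd[].
  by move=> x; split.
move=> cl; apply/(rho_leP _ _ (frac_ge0 e0)) => x ox; rewrite ler_frac ?dist_at_ge0//.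
apply/(dist_at_le e ox); split; last first.
  apply: (H_difference_le HF HG Hh oD _ ox) => y oy.
  have [lF uF lG uG] := off_fin oy; have [lh uh] := ominus_bounds HF HG oy.
  split=> //; first by rewrite (le_trans _ uh)// lo_le_up.
  exact: uniformly_close_up.
rewrite EFinN leeNl -up_fun_opp.
apply: (H_difference_le HG HF (H_continuous_opp Hh) oD _ ox) => y oy.
have [lF uF lG uG] := off_fin oy; have [lh uh] := ominus_bounds HF HG oy.
split=> //; last by apply: uniformly_close_up => //; exact: uniformly_close_sym.
rewrite lo_fun_opp leeNl fin_num_oppeB// addeC (le_trans lh)// lo_le_up//.
Qed.

Lemma rho_xx F : rho F F = 0.
Proof.
apply/eqP; rewrite eq_le rho_ge0 andbT -[leRHS](mul0r (1 + 0)^-1).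
by apply/rho_uniformly_close => //; apply: uniformly_closexx; exact/H_interval_fun/Hnf_H.
Qed.

Lemma rho_eq0 F G : rho F G = 0 -> F = G.
Proof.
move=> r0.
have : sval F = sval G.
  apply: uniformly_close0_eq; [exact: Hnf_H..|].
  by apply/rho_uniformly_close => //; rewrite r0 mul0r.
by case: F G {r0} => [f Pf] [g Pg] /= fg; exact: eq_exist.
Qed.

(** A value 1 of [rho] corresponds to no closeness constant, whence the separate
    appeal to [rho_le1], here and in [rho_triangle]. *)
Lemma rho_symle F G : rho F G <= rho G F.
Proof.
have [/(conj (rho_ge0 G F))/andP/frac_onto[e e0 E]|] := ltP (rho G F) 1.
  rewrite E; apply/rho_uniformly_close => //; apply: uniformly_close_sym.
  by apply/rho_uniformly_close => //; rewrite E.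
exact/le_trans/rho_le1.
Qed.

Lemma rho_sym F G : rho F G = rho G F.
Proof. by apply/eqP; rewrite eq_le !rho_symle. Qed.

Lemma rho_triangle G F H : rho F H <= rho F G + rho G H.
Proof.
have [/(conj (rho_ge0 F G))/andP/frac_onto[a a0 Ea]|F1] := ltP (rho F G) 1; last first.
  by rewrite (le_trans (rho_le1 _ _))// (le_trans F1)// lerDl rho_ge0.
have [/(conj (rho_ge0 G H))/andP/frac_onto[b b0 Eb]|G1] := ltP (rho G H) 1; last first.
  by rewrite (le_trans (rho_le1 _ _))// (le_trans G1)// lerDr rho_ge0.
rewrite Ea Eb (le_trans _ (fracD a0 b0))//; apply/rho_uniformly_close; first by rewrite addr_ge0.
apply: (@uniformly_close_trans _ _ _ _ (sval G)); [exact: Hnf_H..| |].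
  by apply/rho_uniformly_close => //; rewrite Ea.
by apply/rho_uniformly_close => //; rewrite Eb.
Qed.

End Rho.

(** * The metric space and its completeness *)

HB.instance Definition _ (R : realType) (X : topologicalType) :=
  gen_eqMixin (Hnf R X).
HB.instance Definition _ (R : realType) (X : topologicalType) :=
  gen_choiceMixin (Hnf R X).
HB.instance Definition _ (R : realType) (X : topologicalType) :=
  isMetric.Build R (Hnf R X)
    (@rho_xx R X) (@rho_eq0 R X) (@rho_sym R X) (@rho_triangle R X).

Local Open Scope ereal_scope.

Section UniformLimit.
Context {R : realType} {X : topologicalType}.
Implicit Types (l u : X -> \bar R).

(** A Cauchy sequence of extended reals, where all terms from some point on may be
    the same infinity, stays close to its upper limit at the same rate. *)
Lemma limn_esup_near (a : (\bar R)^nat) (e : R) (N : nat) :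
  (forall n m, (N <= n)%N -> (N <= m)%N -> a n <= a m + e%:E) ->
  forall n, (N <= n)%N -> limn_esup a <= a n + e%:E /\ a n <= limn_esup a + e%:E.
Proof.
move=> ae n Nn; split.
  apply: ge_ereal_inf; exists (ereal_sup (a @` [set m | (N <= m)%N])).
    by exists [set m | (N <= m)%N] => //; exact: nbhs_infty_ge.
  by apply: ge_ereal_sup => _ [m Nm <-]; exact: ae.
rewrite -leeBlDr//; apply: le_ereal_inf_tmp => _ [A [k _ kA] <-].
have Am : A (maxn N k) by apply: kA; rewrite /= leq_maxr.
apply: le_ereal_sup_tmp; exists (a (maxn N k)); first by exists (maxn N k).
by rewrite leeBlDr// ae// leq_maxl.
Qed.

(** The pair [(l, u)] is a uniform limit of pairs of bounds of H-continuous
    functions. *)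
Definition uniformly_approx l u :=
  forall e : R, (0 < e)%R -> exists2 g : X -> set \bar R, H_continuous g &
    forall x, [/\ lo g x <= l x + e%:E, l x <= lo g x + e%:E,
                  up g x <= u x + e%:E & u x <= up g x + e%:E].

Lemma lee_addgt0_twice (a b : \bar R) :
  (forall e : R, (0 < e)%R -> a <= b + e%:E + e%:E) -> a <= b.
Proof.
move=> ab; apply/lee_addgt0Pr => e e0.
by rewrite [e]splitr EFinD addeA; apply: ab; rewrite divr_gt0.
Qed.

(** Both the semicontinuity of the bounds and the criterion [H_continuous_itvf]
    pass to the limit, at the price of [2 e] for each [e]. *)
Lemma uniform_limit_H_continuous l u : uniformly_approx l u ->
  (forall x, l x <= u x) /\ H_continuous (itvf l u).
Proof.
move=> appr.
have lu x : l x <= u x.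
  apply: lee_addgt0_twice => e e0; have [g Hg /(_ x)[_ lg gu _]] := appr e e0.
  rewrite (le_trans lg)// leeD2r// (le_trans _ gu)// lo_le_up//.
  exact: H_interval_fun.
split => //; apply: H_continuous_itvf => //.
- apply: lsc_uniform_limit => e e0; have [g Hg ga] := appr e e0.
  by exists (lo g); [exact: H_lsc | move=> x; have [] := ga x].
- apply: lsc_uniform_limit => e e0; have [g Hg ga] := appr e e0.
  exists (fun x => - up g x); first exact: H_usc.
  by move=> x; have [_ _ gu ug] := ga x; rewrite -!leeBlDr// -!fin_num_oppeD// !leeN2.
- move=> W c oW cu x Wx; apply: lee_addgt0_twice => e e0; have [g Hg ga] := appr e e0.
  have [gl _ _ _] := ga x.
  rewrite -leeBlDr// (le_trans _ gl)//.
  apply: (@H_lower_ge _ _ g W (fun=> c - e%:E)) => //; first exact: lsc_cst.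
  by move=> y Wy; rewrite leeBlDr// (le_trans (cu y Wy))//; have [] := ga y.
- move=> W c oW lc x Wx; apply: lee_addgt0_twice => e e0; have [g Hg ga] := appr e e0.
  have [_ _ _ ug] := ga x; rewrite (le_trans ug)// leeD2r//.
  apply: (@H_upper_le _ _ g W (fun=> c + e%:E)) => //.
    exact: (@lsc_cst _ _ (- (c + e%:E))).
  by move=> y Wy; have [gl _ _ _] := ga y; rewrite (le_trans gl)// leeD2r// lc.
Qed.

Lemma Gamma_itvf (f : X -> set \bar R) : interval_fun f ->
  Gamma f = [set x | lo f x = -oo \/ up f x = +oo].
Proof.
move=> If; apply/seteqP; split=> x /=; rewrite /Gamma /=.
  rewrite {1 2}(itvf_lo_up If) => -[/itvfP/andP[+ _]|/itvfP/andP[_]].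
    by rewrite leeNy_eq => /eqP; left.
  by rewrite leye_eq => /eqP; right.
by move=> [<-|<-]; [left; exact: lo_mem | right; exact: up_mem].
Qed.

Lemma closed_Gamma (f : X -> set \bar R) : S_continuous f -> closed (Gamma f).
Proof.
move=> Sf; have [If _] := Sf; rewrite Gamma_itvf// -openC.
rewrite (_ : ~` _ = [set x | -oo < lo f x] `&` [set x | up f x < +oo]).
  by apply: openI; [apply: lsc_open; exact: S_continuous_lsc
                   | apply: usc_open; exact: S_continuous_usc].
apply/seteqP; split=> x /=.
  by move=> /not_orP[/eqP l /eqP u]; rewrite ltNye ltey.
by move=> [l u] [E|E]; [move: l|move: u]; rewrite E ltxx.
Qed.

End UniformLimit.

Section Complete.
Context {R : realType} {X : topologicalType}.

(** The limit is infinite only where the terms close to it with constant 1 are,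
    which makes its set of infinite values nowhere dense. *)
Lemma Hnf_limit (v : nat -> Hnf R X) :
  (forall e : R, (0 < e)%R -> exists N, forall n m, (N <= n)%N -> (N <= m)%N ->
     uniformly_close e (sval (v n)) (sval (v m))) ->
  exists L : Hnf R X, forall e : R, (0 < e)%R -> exists N, forall n, (N <= n)%N ->
     uniformly_close e (sval L) (sval (v n)).
Proof.
move=> cv.
pose l x := limn_esup (fun n => lo (sval (v n)) x).
pose u x := limn_esup (fun n => up (sval (v n)) x).
have apx e : (0 < e)%R -> exists N, forall n, (N <= n)%N -> forall x,
    [/\ lo (sval (v n)) x <= l x + e%:E, l x <= lo (sval (v n)) x + e%:E,
        up (sval (v n)) x <= u x + e%:E & u x <= up (sval (v n)) x + e%:E].
  move=> e0; have [N vN] := cv e e0; exists N => n Nn x.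
  have [|] := @limn_esup_near R (fun n => lo (sval (v n)) x) e N _ n Nn.
    by move=> p q Np Nq; apply: uniformly_close_lo; [exact: Hnf_H..|exact: vN].
  have [|] := @limn_esup_near R (fun n => up (sval (v n)) x) e N _ n Nn.
    by move=> p q Np Nq; apply: uniformly_close_up; [exact: Hnf_H..|exact: vN].
  by move=> uu1 uu2 ll1 ll2; split.
have [lu Hf] : (forall x, l x <= u x) /\ H_continuous (itvf l u).
  apply: uniform_limit_H_continuous => e /apx[N vN].
  by exists (sval (v N)); [exact: Hnf_H | exact: vN].
have nf : nearly_finite (itvf l u).
  split; first exact: closed_Gamma Hf.1.
  have [N vN] := apx 1%R ltr01.
  have [_ [_ vnd]] := svalP (v N).
  rewrite /nowhere_dense -subset0; move: vnd; rewrite /nowhere_dense => <-.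
  apply: interiorS; apply: closureS.
  rewrite !Gamma_itvf; [|exact/H_interval_fun/Hnf_H|exact: H_interval_fun].
  rewrite lo_itvf// up_itvf// => x /= lux.
  have [+ _ _] := vN N (leqnn N) x.
  case: lux => ->.
    by move=> h _; left; apply/eqP; rewrite -leeNy_eq.
  move=> _; rewrite leye_eq => h; right.
  by move: h; case: (up _ x).
exists (exist _ (itvf l u) (conj Hf nf)) => e /apx[N vN]; exists N => n Nn x.
have [a b c d] := vN n Nn x.
rewrite /= lo_itvf// up_itvf//; split.
  by rewrite (le_trans b)// leeD2r// lo_le_up//; exact/H_interval_fun/Hnf_H.
by rewrite (le_trans a)// leeD2r.
Qed.

Lemma Hnf_complete (v : nat -> Hnf R X) :
  cauchy (v @ \oo) -> exists L : Hnf R X, v @ \oo --> L.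
Proof.
have frac_gt0 (e : R) : (0 < e)%R -> (0 < e / (1 + e))%R.
  by move=> e0; rewrite divr_gt0// addr_gt0.
move=> /cauchy_ballP cv.
have [|L vL] := @Hnf_limit v.
  move=> e e0; have := cv _ (frac_gt0 _ e0).
  rewrite near_map2 => -[[A B] [[N1 _ N1A] [N2 _ N2B]] AB].
  exists (maxn N1 N2) => n m; rewrite !geq_max => /andP[n1 _] /andP[_ m2].
  apply/rho_uniformly_close; first exact: ltW.
  have := AB (n, m) (conj (N1A n n1) (N2B m m2)).
  by rewrite /= ballEmdist => /ltW.
exists L; apply/cvg_ballP => e e0; have [N vN] := vL e e0.
near=> n; rewrite ballEmdist /=.
apply: (@le_lt_trans _ _ (e / (1 + e))%R).
  by apply/rho_uniformly_close; [exact: ltW | apply: vN; near: n; exact: nbhs_infty_ge].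
by rewrite ltr_pdivrMr ?addr_gt0// mulrDr mulr1 ltrDl mulr_gt0.
Unshelve. all: by end_near. Qed.

End Complete.

Theorem theorem8 (R : realType) (X : topologicalType)
    (crX : completely_regular_space X) :
  complete_metric (@rho R X).
Proof.
exists (Metric.class (Hnf R X : metricType R)); split; first by [].
exact: Hnf_complete.
Qed.
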